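(* Let $A\in\mathbb{C}^{n\times n}$ be Hermitian positive semidefinite with spectral radius $\rho(A)$, let $\alpha\in(0,1)$, and denote by $d(i,j)$ the geodesic distance of the nodes $i$ and $j$ in the graph of $A$. Then for all $i,j$ with $d(i,j)\ge 2$, $$ \begin{aligned} |[A^\alpha]_{ij}|\le \frac{\alpha}{\Gamma(1-\alpha)}\Bigg(&\frac{10\,e^{d(i,j)}\rho(A)^\alpha}{4^\alpha\, d(i,j)^{d(i,j)}}\;\gamma\!\left(d(i,j)-\alpha-1,\frac{d(i,j)}{2}\right)\\ &+10\left(\frac{5\rho(A)}{4d(i,j)^2}\right)^{\alpha}\left(\Gamma\!\left(\alpha,\frac45\right)-\Gamma\!\left(\alpha,\frac{2d(i,j)}{5}\right)\right)+\frac{\rho(A)^\alpha}{\alpha\, d(i,j)^{2\alpha}}\Bigg). \end{aligned} $$ In particular, for $\alpha=\frac12$, $$ \begin{aligned} |[\sqrt{A}]_{ij}|\le \frac{1}{2\sqrt{\pi}}\Bigg(&\frac{10\,e^{d(i,j)}\sqrt{\pi\rho(A)}}{2\,d(i,j)^{d(i,j)}}\;\gamma\!\left(d(i,j)-\frac32,\frac{d(i,j)}{2}\right)\\ &+\frac{5\sqrt{5\pi\rho(A)}}{d(i,j)}\left(\operatorname{erfc}\!\left(\frac{2}{\sqrt5}\right)-\operatorname{erfc}\!\left(\sqrt{\frac{2d(i,j)}{5}}\right)\right)+\frac{2\sqrt{\rho(A)}}{d(i,j)}\Bigg). \end{aligned} $$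
   Context: $\Gamma(z)$ is the gamma function; $\Gamma(z,s)=\int_s^\infty t^{z-1}e^{-t}\,\mathrm{d}t$ and $\gamma(z,s)=\int_0^s t^{z-1}e^{-t}\,\mathrm{d}t$ are the upper and lower incomplete gamma functions; $\operatorname{erfc}(z)=1-\operatorname{erf}(z)$ with $\operatorname{erf}(z)=\frac{1}{\sqrt\pi}\int_{-z}^{z}e^{-t^2}\,\mathrm{d}t$. For Hermitian positive semidefinite $A=V\operatorname{diag}(\lambda_1,\dots,\lambda_n)V^H$ with $V$ unitary, $A^\alpha=V\operatorname{diag}(\lambda_1^\alpha,\dots,\lambda_n^\alpha)V^H$ (with $0^\alpha=0$), and $\sqrt A=A^{1/2}$. The graph of $A=(a_{ij})$ has nodes $1,\dots,n$ and edges $\{(i,j): a_{ij}\ne 0,\ i\ne j\}$. The geodesic distance $d(i,j)$ is the length of a shortest path from $i$ to $j$ in this graph, with $d(i,j)=\infty$ if no path exists. *)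

(* Defs.v *)
From HB Require Import structures.
From mathcomp Require Import all_boot all_order all_algebra.
From mathcomp Require Import all_classical all_reals all_analysis.
From mathcomp Require Import complex.

Set Implicit Arguments.
Unset Strict Implicit.
Unset Printing Implicit Defensive.

Import Order.TTheory GRing.Theory Num.Theory.
Import numFieldNormedType.Exports.

Local Open Scope classical_set_scope.
Local Open Scope ring_scope.
Local Open Scope complex_scope.
Local Open Scope sesquilinear_scope.

(* [Rintegral] is 0 when the integral diverges; [lower_gamma z s] is
   meaningful for 0 < z and 0 <= s, and [upper_gamma z s] for 0 < s, or for
   0 < z and s = 0. *)
Definition lower_gamma (R : realType) (z s : R) : R :=
  \int[lebesgue_measure]_(t in `[0, s]) (t `^ (z - 1) * expR (- t)).

Definition upper_gamma (R : realType) (z s : R) : R :=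
  \int[lebesgue_measure]_(t in `[s, +oo[) (t `^ (z - 1) * expR (- t)).

Definition Gamma (R : realType) (z : R) : R := upper_gamma z 0.

(* The interval is empty for z < 0, so this is the error function for 0 <= z. *)
Definition erf (R : realType) (z : R) : R :=
  (Num.sqrt pi)^-1 *
  \int[lebesgue_measure]_(t in `[- z, z]) expR (- t ^+ 2).

Definition erfc (R : realType) (z : R) : R := 1 - erf z.

(* In the partial order of R[i], 0 <= c means that c is real and nonnegative. *)
Definition psdmx (R : realType) n (A : 'M[R[i]]_n) : Prop :=
  A \is hermsymmx /\
  (forall x : 'cV[R[i]]_n, 0 <= (x^t* *m A *m x) ord0 ord0).

Definition spectral_radius (R : realType) n (A : 'M[R[i]]_n) : R :=
  sup [set r : R | exists2 a : R[i], eigenvalue A a & `|a| = r%:C].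

(* [spectralmx A] is V^H in A = V diag(lambda) V^H; its inverse is V since it
   is unitary. That any other unitary diagonalization gives the same matrix is
   [mxpowR_unitary] below. *)
Definition mxpowR (R : realType) n (A : 'M[R[i]]_n) (alpha : R) : 'M[R[i]]_n :=
  invmx (spectralmx A) *m
  diag_mx (map_mx (fun l : R[i] => (complex.Re l `^ alpha)%:C)
                  (spectral_diag A)) *m
  spectralmx A.

Lemma mxpowR_unitary (R : realType) n (A V : 'M[R[i]]_n) (l : 'rV[R]_n)
    (alpha : R) :
  V \is unitarymx ->
  A = V *m diag_mx (map_mx (fun x => x%:C) l) *m V^t* ->
  mxpowR A alpha = V *m diag_mx (map_mx (fun x => (x `^ alpha)%:C) l) *m V^t*.
Proof.
move=> Vu AE.
have Vinv : V^t* = invmx V by rewrite invmx_unitary.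
have Vunit := unitarymx_unit Vu.
have /orthomx_spectralP AS : A \is normalmx.
  apply/orthomx_spectral_subproof.
  exists (V^t*, map_mx (fun x : R => x%:C) l); first by rewrite trmxC_unitary.
  by rewrite /= {1}Vinv invmxK.
rewrite /mxpowR.
set P := spectralmx A in AS *; set s := spectral_diag A in AS *.
have Punit : P \in unitmx by exact: spectral_unit.
have MD : (P *m V) *m diag_mx (map_mx (fun x : R => x%:C) l)
          = diag_mx s *m (P *m V).
  apply: (can_inj (mulmxK (_ : invmx V \in unitmx))).
    by rewrite unitmx_inv.
  rewrite -[RHS]mulmxA -(mulmxA P V (invmx V)) mulmxV // mulmx1.
  apply: (can_inj (mulKmx (_ : invmx P \in unitmx))).
    by rewrite unitmx_inv.
  rewrite [RHS]mulmxA -AS AE Vinv !mulmxA mulVmx //.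
  by rewrite mul1mx.
have MF : (P *m V) *m diag_mx (map_mx (fun x : R => (x `^ alpha)%:C) l)
  = diag_mx (map_mx (fun z : R[i] => (complex.Re z `^ alpha)%:C) s) *m (P *m V).
  apply/matrixP => i j.
  move/matrixP/(_ i j): MD.
  rewrite !mul_mx_diag !mul_diag_mx !mxE.
  set m := \sum_(_ < _) _.
  have [->|m0] := eqVneq m 0; first by rewrite !(mul0r, mulr0).
  rewrite mulrC => /(mulIf m0) <- /=.
  by rewrite mulrC.
rewrite Vinv.
apply: (can_inj (mulmxK Vunit)).
rewrite mulmxKV // -!mulmxA -MF !mulmxA mulVmx // mul1mx //.
Qed.

Definition mx_edge (R : realType) n (A : 'M[R[i]]_n) : rel 'I_n :=
  fun i j => (i != j) && (A i j != 0).

Definition walk_of_length (T : finType) (e : rel T) (x y : T) : pred nat :=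
  fun k => [exists p : k.-tuple T, path e x p && (last x p == y)].

(* [None] stands for the distance infinity. *)
Definition geodesic_dist (T : finType) (e : rel T) (x y : T) : option nat :=
  if pselect (exists k, walk_of_length e x y k) is left h
  then Some (ex_minn h) else None.

(* Main.v *)
Require Import Defs.
From mathcomp Require Import all_boot all_order all_algebra.
From mathcomp Require Import all_classical all_reals all_analysis.
From mathcomp Require Import complex.
From mathcomp Require Import measurable_realfun.
From mathcomp Require Import ring lra zify.
Import Order.TTheory GRing.Theory Num.Theory.
Import numFieldNormedType.Exports.
Local Open Scope ring_scope.
Local Open Scope complex_scope.

Set Implicit Arguments.
Unset Strict Implicit.
Unset Printing Implicit Defensive.

Local Open Scope classical_set_scope.
Local Open Scope ring_scope.
Local Open Scope complex_scope.

(** The third term alone is an upper bound; the other two are nonnegative.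
    If [d = d(i,j)], the [(i,j)] entry of [p(A)] vanishes for every polynomial
    [p] of degree less than [d], so [|A^a_ij|] is at most the distance on
    [[0, rho]] from [x^a] to such polynomials.  With [x = cos^2 t], the Fourier
    coefficients of [cos(t)^(2a)] telescope: up to normalization the tail from
    index [d] on is [prod_(0 < k < d) (k - a) / (k + a)], and Bernoulli's
    inequality bounds the normalized tail by [(1 - a) / d^(2a)].  Finally
    [Gamma(1 - a) <= 1 / (1 - a)], so this is at most
    [1 / (Gamma(1 - a) d^(2a))].  For [a = 1/2], [sqrt pi <= 2] is enough. *)

(** * Chebyshev expansion of a power *)

(** Bernoulli's inequality: a concave power lies below its tangent at 1. With [L = ln t], dividing
    by [t^a] leaves [1 <= a e^((1-a)L) + (1-a) e^(-aL)]; apply [e^x >= 1 + x] twice, and the terms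
    in [L] cancel. *)
Lemma powR_le_affine (R : realType) (a t : R) :
  0 <= a -> a <= 1 -> 0 < t -> t `^ a <= a * t + (1 - a).
Proof.
move=> a0 a1 t0; rewrite /powR gt_eqF//.
have tE : t = expR (a * ln t) * expR ((1 - a) * ln t).
  by rewrite -expRD -mulrDl addrC subrK mul1r lnK.
have VE : expR (a * ln t) * expR (- (a * ln t)) = 1 :> R.
  by rewrite -expRD subrr expR0.
have h1 := expR_ge1Dx ((1 - a) * ln t).
have h2 := expR_ge1Dx (- (a * ln t)).
have h : 1 <= a * expR ((1 - a) * ln t) + (1 - a) * expR (- (a * ln t)).
  apply: le_trans (lerD (ler_wpM2l a0 h1) (ler_wpM2l _ h2)); last lra.
  by rewrite le_eqVlt; apply/orP; left; apply/eqP; ring.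
apply: le_trans (_ : expR (a * ln t) * (a * expR ((1 - a) * ln t)
    + (1 - a) * expR (- (a * ln t))) <= _).
  by rewrite -[leLHS]mulr1 ler_wpM2l// expR_ge0.
by rewrite mulrDr mulrCA -tE mulrCA VE mulr1.
Qed.

(* Up to a constant factor, [cos(t)^(2a)] has the Fourier expansion
   [1 + sum_k (-1)^k c_k cos(2(k+1)t)] with [c_k = cheb_coef a k]; the sum of
   the [c_l] for [l >= k] is [cheb_tail a k]. *)
Definition cheb_tail (R : realType) (a : R) (m : nat) : R :=
  \prod_(k < m) ((k.+1%:R - a) / (k.+1%:R + a)).

Definition cheb_coef (R : realType) (a : R) (k : nat) : R :=
  cheb_tail a k - cheb_tail a k.+1.

Lemma cheb_tailS (R : realType) (a : R) m :
  cheb_tail a m.+1 = cheb_tail a m * ((m.+1%:R - a) / (m.+1%:R + a)).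
Proof. by rewrite /cheb_tail big_ord_recr. Qed.

Lemma cheb_tail0 (R : realType) (a : R) : cheb_tail a 0 = 1.
Proof. by rewrite /cheb_tail big_ord0. Qed.

Lemma cheb_tail_ge0 (R : realType) (a : R) m :
  0 <= a -> a <= 1 -> 0 <= cheb_tail a m.
Proof.
move=> a0 a1; apply: prodr_ge0 => k _; have := ler0n R k.
by rewrite -natr1 => k0; apply: divr_ge0; lra.
Qed.

Lemma cheb_coefE (R : realType) (a : R) k : 0 <= a ->
  cheb_coef a k = cheb_tail a k * (2 * a / (k.+1%:R + a)).
Proof.
move=> a0; rewrite /cheb_coef cheb_tailS.
have k0 : k.+1%:R + a != 0 by rewrite gt_eqF// ltr_wpDr.
by move: k0; move: (k.+1%:R : R) => K k0; field.
Qed.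

Lemma cheb_coef_ge0 (R : realType) (a : R) k :
  0 <= a -> a <= 1 -> 0 <= cheb_coef a k.
Proof.
move=> a0 a1; rewrite cheb_coefE//; apply: mulr_ge0; first exact: cheb_tail_ge0.
by apply: divr_ge0; [exact: mulr_ge0|exact: addr_ge0].
Qed.

(** The ratio of consecutive coefficients is [(k + 1 - a) / (k + 2 + a)]. This serves to pair the
    terms of the alternating sum at [x = 1]. *)
Lemma cheb_coef_decr (R : realType) (a : R) k :
  0 <= a -> a <= 1 -> cheb_coef a k.+1 <= cheb_coef a k.
Proof.
move=> a0 a1; rewrite !cheb_coefE// cheb_tailS -mulrA.
apply: ler_wpM2l; first exact: cheb_tail_ge0.
have [k0 k1] : 0 <= k%:R :> R /\ k.+2%:R = k.+1%:R + 1 :> R by rewrite natr1.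
have k2 : k.+1%:R = k%:R + 1 :> R by rewrite natr1.
rewrite {}k1 {}k2; move: (k%:R : R) k0 => K K0.
have -> : (K + 1 - a) / (K + 1 + a) * (2 * a / (K + 1 + 1 + a)) =
    2 * a / (K + 1 + a) * ((K + 1 - a) / (K + 1 + 1 + a)) by field; lra.
rewrite ler_piMr//; first by apply: divr_ge0; lra.
by rewrite ler_pdivrMr; lra.
Qed.

(** Induction on [d], with [2^a <= 1 + a] behind the base case. The factor [1 + a] is later
    cancelled by the normalization of the sums at [x = 1]. *)
Lemma cheb_tail_le (R : realType) (a : R) d : 0 <= a -> a <= 1 ->
  cheb_tail a d.+1 <= (1 - a) * (1 + a) * d.+2%:R `^ (- (2 * a)).
Proof.
move=> a0 a1; elim: d => [|d IH].
  rewrite cheb_tailS cheb_tail0 mul1r.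
  rewrite -mulrA ler_wpM2l ?subr_ge0//.
  rewrite powRN ler_pdivlMr ?powR_gt0// ler_pdivrMl; last lra.
  rewrite mulrC powRrM powR_mulrn ?powR_ge0// -expr2.
  rewrite ler_pXn2r ?nnegrE ?powR_ge0//; last lra.
  by have := @powR_le_affine R a 2 a0 a1 ltac:(lra); lra.
rewrite cheb_tailS; set D : R := d.+2%:R.
have D2 : 2 <= D by rewrite /D ler_nat.
have D0 : 0 < D by lra.
have -> : d.+3%:R = D + 1 :> R by rewrite natr1.
apply: le_trans (ler_wpM2r _ IH) _; first by apply: divr_ge0; lra.
rewrite -[leLHS]mulrA ler_wpM2l//; first by rewrite mulr_ge0; lra.
rewrite -/D; clearbody D; rewrite !powRN ![2 * a]mulrC !powRrM !powR_mulrn ?powR_ge0//.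
set u := D `^ a; set v := (D + 1) `^ a.
have u0 : 0 < u by rewrite powR_gt0.
have v0 : 0 < v by rewrite powR_gt0//; lra.
(* Bernoulli for [(1 + 1/D)^a]; it then remains to see that [(D - a) (1 + a/D)^2 <= D + a]. *)
have vu : v <= u * (1 + a / D).
  have -> : v = u * (1 + D^-1) `^ a.
    have iD : 0 <= D^-1 by rewrite invr_ge0 ltW.
    rewrite -powRM; [|lra|lra].
    by congr (_ `^ _); field; lra.
  rewrite ler_pM2l//; apply: le_trans (powR_le_affine _ _ _) _ => //.
    by rewrite addr_gt0// invr_gt0.
  by rewrite le_eqVlt; apply/orP; left; apply/eqP; ring.
have vu2 : v ^+ 2 <= (u * (1 + a / D)) ^+ 2.
  by rewrite ler_pXn2r ?nnegrE// ?(le_trans _ vu)// ltW.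
rewrite -[leRHS]mulr1 ler_pdivlMl ?exprn_gt0//.
rewrite mulrCA ler_pdivrMl ?exprn_gt0// mulr1.
rewrite mulrA ler_pdivrMr; last lra.
rewrite mulrC.
apply: le_trans (ler_wpM2l (_ : 0 <= D - a) vu2) _; first lra.
have -> : (D - a) * (u * (1 + a / D)) ^+ 2
        = u ^+ 2 * (D + a) * (1 - (a / D) ^+ 2) by field; lra.
rewrite ler_piMr//; first by rewrite mulr_ge0 ?sqr_ge0//; lra.
by have := sqr_ge0 (a / D); lra.
Qed.

(* [T_k(2x - 1)], where [T_k] is the Chebyshev polynomial; the iterated pair
   holds two consecutive ones. *)
Definition shifted_cheb (R : realType) (k : nat) : {poly R} :=
  (iter k (fun pq : {poly R} * {poly R} =>
     (pq.2, 2%:P * (2%:P * 'X - 1) * pq.2 - pq.1)) (1, 2%:P * 'X - 1)).1.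

Lemma shifted_chebSS (R : realType) k :
  shifted_cheb R k.+2 =
  2%:P * (2%:P * 'X - 1) * shifted_cheb R k.+1 - shifted_cheb R k.
Proof. by []. Qed.

Lemma size_shifted_cheb (R : realType) k : (size (shifted_cheb R k) <= k.+1)%N.
Proof.
have s1 : (size (2%:P * 'X - 1 : {poly R})%R <= 2)%N.
  rewrite (leq_trans (size_polyD _ _))// geq_max size_polyN size_poly1 andbT.
  rewrite mul_polyC (leq_trans (size_scale_leq _ _))// size_polyX//.
suff [] : (size (shifted_cheb R k) <= k.+1)%N /\
  (size (shifted_cheb R k.+1) <= k.+2)%N by [].
elim: k => [|k [h1 h2]]; first by rewrite /shifted_cheb /= size_poly1.
split=> //; rewrite shifted_chebSS.
rewrite (leq_trans (size_polyD _ _))// geq_max size_polyN.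
rewrite (leq_trans h1 (leqW (leqnSn _))) andbT.
rewrite -mulrA mul_polyC (leq_trans (size_scale_leq _ _))//.
rewrite (leq_trans (size_polyMleq _ _))//.
by rewrite -subn1 leq_subLR (leq_trans (leq_add s1 h2)).
Qed.

Lemma shifted_cheb_cos (R : realType) k (t : R) :
  (shifted_cheb R k).[cos t ^+ 2] = cos (2 * k%:R * t).
Proof.
have c2 : 2 * cos t ^+ 2 - 1 = cos (2 * t).
  have -> : 2 * t = t + t by ring.
  by rewrite cosD; have := cos2Dsin2 t; rewrite !expr2; lra.
have E1 : (2%:P * 'X - 1).[cos t ^+ 2] = cos (2 * t).
  by rewrite -c2 hornerD hornerN hornerM !hornerC hornerX.
suff [] : (shifted_cheb R k).[cos t ^+ 2] = cos (2 * k%:R * t) /\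
  (shifted_cheb R k.+1).[cos t ^+ 2] = cos (2 * k.+1%:R * t) by [].
elim: k => [|k [h1 h2]].
  by rewrite /shifted_cheb /= mulr0 mul0r cos0 mulr1 E1 hornerC.
split=> //; rewrite shifted_chebSS hornerD hornerN !hornerM h1 h2 E1 hornerC.
have -> : 2 * k.+2%:R * t = 2 * k.+1%:R * t + 2 * t.
  by rewrite -[in LHS]natr1; ring.
have -> : 2 * k%:R * t = 2 * k.+1%:R * t - 2 * t.
  by rewrite -[in RHS]natr1; ring.
by rewrite cosB cosD; ring.
Qed.

Definition cheb_sum (R : realType) (a : R) (N : nat) : {poly R} :=
  1 + \sum_(k < N) ((- 1) ^+ k * cheb_coef a k) *: shifted_cheb R k.+1.

Lemma cheb_sumS (R : realType) (a : R) N : cheb_sum a N.+1 =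
  cheb_sum a N + ((- 1) ^+ N * cheb_coef a N) *: shifted_cheb R N.+1.
Proof. by rewrite /cheb_sum big_ord_recr /= addrA. Qed.

Lemma size_cheb_sum (R : realType) (a : R) N : (size (cheb_sum a N) <= N.+1)%N.
Proof.
elim: N => [|N IH]; first by rewrite /cheb_sum big_ord0 addr0 size_poly1.
rewrite cheb_sumS (leq_trans (size_polyD _ _))// geq_max (leqW IH) /=.
by rewrite (leq_trans (size_scale_leq _ _))// size_shifted_cheb.
Qed.

Lemma cheb_sum_cos (R : realType) (a : R) N t : (cheb_sum a N).[cos t ^+ 2] =
  1 + \sum_(k < N) (- 1) ^+ k * cheb_coef a k * cos (2 * k.+1%:R * t).
Proof.
rewrite hornerD hornerC horner_sum; congr (_ + _); apply: eq_bigr => k _.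
by rewrite hornerZ shifted_cheb_cos.
Qed.

(** At [t = pi/2] the [k]-th cosine is [(-1)^(k+1)], so the signs cancel and [1 - sum c_k]
    telescopes. *)
Lemma cheb_sum0 (R : realType) (a : R) N : (cheb_sum a N).[0] = cheb_tail a N.
Proof.
have := cheb_sum_cos a N (pi / 2); rewrite cos_pihalf expr0n /= => ->.
elim: N => [|N IH]; first by rewrite big_ord0 cheb_tail0 addr0.
rewrite big_ord_recr /= addrA IH.
have -> : cos (2 * N.+1%:R * (pi / 2)) = (- 1) ^+ N.+1 :> R.
  have -> : 2 * N.+1%:R * (pi / 2) = N.+1%:R * pi :> R by field.
  elim: (N.+1) => [|m IHm]; first by rewrite mul0r cos0.
  by rewrite -natr1 mulrDl mul1r cosDpi IHm exprS mulN1r.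
rewrite exprS mulN1r mulrN mulrAC -expr2 -exprM mulnC exprM sqrrN expr1n.
by rewrite expr1n mul1r /cheb_coef; ring.
Qed.

(** At [x = 1] the series alternates with decreasing coefficients. For an even number of terms,
    consecutive pairs are nonnegative, and the first pair already contributes at least [a]. *)
Lemma cheb_sum1_ge (R : realType) (a : R) m : 0 <= a -> a <= 1 ->
  1 + a <= (cheb_sum a m.+1.*2).[1].
Proof.
move=> a0 a1.
have T1 k : (shifted_cheb R k).[1] = 1.
  by have := shifted_cheb_cos k (0 : R); rewrite mulr0 cos0 expr1n.
have E n : (cheb_sum a n.+1.*2).[1] = (cheb_sum a n.*2).[1] +
    (cheb_coef a n.*2 - cheb_coef a n.*2.+1).
  rewrite doubleS !cheb_sumS !hornerD !hornerZ !T1 exprS -signr_odd odd_double.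
  by rewrite expr0; ring.
elim: m => [|m IH]; last first.
  by rewrite E (le_trans IH)// lerDl subr_ge0 cheb_coef_decr.
rewrite E /cheb_sum big_ord0 addr0 hornerC !cheb_coefE// cheb_tailS cheb_tail0.
rewrite -subr_ge0.
have -> : 1 + (1 * (2 * a / (1%:R + a)) -
   1 * ((1%:R - a) / (1%:R + a)) * (2 * a / (2%:R + a))) - (1 + a) =
   a ^+ 2 * (1 - a) / ((1 + a) * (2 + a)) by field; lra.
apply: divr_ge0; last by rewrite mulr_ge0; lra.
by rewrite mulr_ge0 ?sqr_ge0//; lra.
Qed.

(** Each cosine is at most 1 in absolute value, and the remaining sum of coefficients telescopes. *)
Lemma cheb_sum_dist (R : realType) (a : R) N k t : 0 <= a -> a <= 1 ->
  `|(cheb_sum a (N + k)).[cos t ^+ 2] - (cheb_sum a N).[cos t ^+ 2]|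
    <= cheb_tail a N - cheb_tail a (N + k).
Proof.
move=> a0 a1; elim: k => [|k IH]; first by rewrite addn0 !subrr normr0.
rewrite addnS cheb_sumS hornerD hornerZ shifted_cheb_cos addrAC.
apply: le_trans (ler_normD _ _) _.
have -> : cheb_tail a N - cheb_tail a (N + k).+1 =
  cheb_tail a N - cheb_tail a (N + k) + cheb_coef a (N + k).
  by rewrite /cheb_coef; ring.
apply: lerD => //; rewrite !normrM normrX normrN1 expr1n mul1r.
rewrite (ger0_norm (cheb_coef_ge0 _ _ _))//.
by rewrite ler_piMr ?cheb_coef_ge0// ler_norml cos_geN1 cos_le1.
Qed.

(** * Convergence of the expansion through a differential equation *)

Definition trig_sum (R : realType) (a : R) N (t : R) : R :=
  1 + \sum_(k < N) (- 1) ^+ k * cheb_coef a k * cos (2 * k.+1%:R * t).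

Definition trig_sum' (R : realType) (a : R) N (t : R) : R :=
  \sum_(k < N) (- 1) ^+ k * cheb_coef a k *
    - (2 * k.+1%:R * sin (2 * k.+1%:R * t)).

Lemma trig_sumS (R : realType) (a : R) N (t : R) : trig_sum a N.+1 t =
  trig_sum a N t + (- 1) ^+ N * cheb_coef a N * cos (2 * N.+1%:R * t).
Proof. by rewrite /trig_sum big_ord_recr /= addrA. Qed.

Lemma trig_sum'S (R : realType) (a : R) N (t : R) : trig_sum' a N.+1 t =
  trig_sum' a N t + (- 1) ^+ N * cheb_coef a N *
    - (2 * N.+1%:R * sin (2 * N.+1%:R * t)).
Proof. by rewrite /trig_sum' big_ord_recr. Qed.

Lemma is_derive_cosM (R : realType) (m t : R) :
  is_derive t 1 (fun x => cos (m * x)) (- (m * sin (m * t))).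
Proof.
have dm : is_derive t (1 : R) (fun x : R => m * x) m.
  by apply: is_derive_eq; rewrite [_ *: _]mulr1.
have := is_derive1_comp (is_derive_cos (m * t)) dm.
by rewrite mulNr mulrC.
Qed.

Lemma is_derive_trig_sum (R : realType) (a : R) (N : nat) (t : R) :
  is_derive t 1 (trig_sum a N) (trig_sum' a N t).
Proof.
elim: N => [|N IH].
  have -> : trig_sum a 0 = cst 1.
    by apply/funext => x; rewrite /trig_sum big_ord0 addr0.
  by rewrite /trig_sum' big_ord0; exact: is_derive_cst.
have -> : trig_sum a N.+1 = trig_sum a N +
    ((- 1) ^+ N * cheb_coef a N) *: (fun x => cos (2 * N.+1%:R * x)).
  by apply/funext => x; rewrite trig_sumS.
rewrite trig_sum'S.
by apply: is_deriveD; apply: is_deriveZ; exact: is_derive_cosM.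
Qed.

(* [cos t ^ (2 a)] solves [cos t * y' + 2 a * sin t * y = 0]; the coefficients
   are those for which the partial sums of its Fourier series leave a single
   frequency as a residual. *)
Lemma trig_sum_ode (R : realType) (a : R) N t : 0 <= a ->
  cos t * trig_sum' a N t + 2 * a * sin t * trig_sum a N t =
  (- 1) ^+ N * (2 * a * cheb_tail a N) * sin ((2 * N%:R + 1) * t).
Proof.
move=> a0; elim: N => [|N IH].
  by rewrite /trig_sum /trig_sum' !big_ord0 cheb_tail0 !mulr0 !add0r addr0 !mul1r !mulr1.
rewrite [LHS](_ : _ =
    cos t * trig_sum' a N t + 2 * a * sin t * trig_sum a N t +
    (- 1) ^+ N * cheb_coef a N *
    (cos t * - (2 * N.+1%:R * sin (2 * N.+1%:R * t)) +
     2 * a * sin t * cos (2 * N.+1%:R * t))); last first.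
  by rewrite trig_sumS trig_sum'S; ring.
rewrite {}IH.
(* With [u = 2(N+1)t], the old residual is a multiple of [sin(u - t)], and the new term contributes
   both [sin(u - t)] and [sin(u + t)]. The value of [c_N] is the one that cancels the former. *)
have -> : (2 * N%:R + 1) * t = 2 * N.+1%:R * t - t by rewrite -natr1; ring.
have -> : (2 * N.+1%:R + 1) * t = 2 * N.+1%:R * t + t by ring.
rewrite sinB sinD cheb_coefE// cheb_tailS exprS.
have : N.+1%:R + a != 0 by rewrite gt_eqF// ltr_wpDr.
move: (N.+1%:R : R) => K K0.
by field.
Qed.


(* Mean value theorem for [y(s) * cos(s)^(-2a)], [y] the partial sum, between
   [0] and [arccos (sqrt x)]. *)
Lemma cheb_sum_approx_pos (R : realType) (a x : R) : 0 <= a -> a <= 1 ->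
  0 < x -> x <= 1 -> exists2 K : R, 0 <= K & forall N : nat,
  `|(cheb_sum a N).[x] - (cheb_sum a N).[1] * x `^ a| <= K * cheb_tail a N.
Proof.
move=> a0 a1 x0 x1.
pose c := Num.sqrt x; have c0 : 0 < c by rewrite sqrtr_gt0.
have c1 : c <= 1 by rewrite -[leRHS]sqrtr1 ler_sqrt.
have cI : -1 <= c <= 1 by rewrite c1 andbT; lra.
pose t := acos c.
have ct : cos t = c by rewrite acosK// in_itv.
have t0 : 0 <= t by exact: acos_ge0.
have tpi : t <= pi by exact: acos_lepi.
have xE : x = cos t ^+ 2 by rewrite ct sqr_sqrtr// ltW.
have cosge s : s \in `[0, t] -> c <= cos s.
  rewrite in_itv /= => /andP[s0 st].
  have spi := le_trans st tpi.
  by rewrite leNgt -ct ltr_cos ?in_itv /= ?s0 ?t0 ?spi ?tpi// -leNgt.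
have cosgt s : s \in `[0, t] -> 0 < cos s.
  by move=> /cosge; exact: lt_le_trans.
pose r := - (2 * a).
pose H N (s : R) := trig_sum a N s * cos s `^ r.
(* Differentiating [H] gives [cos^(r-1)] times the left side of the differential equation, which is
   replaced here by its residual. *)
pose H' N (s : R) := cos s `^ (r - 1) *
  ((- 1) ^+ N * (2 * a * cheb_tail a N) * sin ((2 * N%:R + 1) * s)).
have dH N s : s \in `[0, t] -> is_derive s 1 (H N) (H' N s).
  move=> /cosgt s0.
  have d1 := is_derive1_comp (is_derive1_powR r s0) (is_derive_cos s).
  have := is_deriveM (is_derive_trig_sum a N s) d1.
  move=> h; apply: (is_derive_eq h); rewrite /H' -trig_sum_ode// /r /=.
  have -> : cos s `^ (- (2 * a)) = cos s `^ (- (2 * a) - 1) * cos s.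
    rewrite -{3}(powRr1 (ltW s0)) -powRD ?subrK//.
    by rewrite (gt_eqF s0) implybT.
  by rewrite /= /GRing.scale /=; ring.
(* [c^(2a)] removes the weight at the endpoint [t], [c^(r-1)] bounds [cos^(r-1)] on the interval
   since [r - 1 < 0], [2a] comes from the residual, and [t] is the length of the interval. *)
exists (c `^ (2 * a) * c `^ (r - 1) * (2 * a) * t).
  by rewrite !mulr_ge0 ?powR_ge0.
move=> N.
have dHo s : s \in `]0, t[ -> is_derive s 1 (H N) (H' N s).
  by move=> /subset_itv_oo_cc; exact: dH.
have cH : {within `[0, t], continuous (H N)}.
  apply: derivable_within_continuous => s sI.
  by have [] := dH N s sI.
have [s sI HE] := MVT_segment t0 dHo cH.
have S0 : trig_sum a N 0 = (cheb_sum a N).[1].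
  by rewrite /trig_sum -cheb_sum_cos cos0 expr1n.
have St : trig_sum a N t = (cheb_sum a N).[x] by rewrite xE cheb_sum_cos.
have cVr : c `^ (2 * a) * c `^ r = 1.
  by rewrite /r powRN mulfV// powR_eq0 gt_eqF.
have xa : x `^ a = c `^ (2 * a).
  by rewrite powRrM powR_mulrn ?ltW// xE ct.
rewrite {1}/H {1}/H S0 St ct cos0 powR1 mulr1 subr0 in HE.
have -> : (cheb_sum a N).[x] - (cheb_sum a N).[1] * x `^ a =
  c `^ (2 * a) * (H' N s * t).
  rewrite -HE xa mulrBr; congr (_ - _); last by rewrite mulrC.
  by rewrite mulrCA cVr mulr1.
rewrite normrM (ger0_norm (powR_ge0 _ _)) normrM (ger0_norm t0).
rewrite -!mulrA; apply: ler_wpM2l; first exact: powR_ge0.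
rewrite mulrA [leRHS](_ : _ =
  (c `^ (r - 1) * (2 * a * cheb_tail a N)) * t); last by ring.
apply: ler_wpM2r => //; rewrite /H' normrM (ger0_norm (powR_ge0 _ _)).
apply: ler_pM; rewrite ?powR_ge0 ?normr_ge0//.
  have cs := cosge s sI.
  have q0 : 0 <= - (r - 1) by rewrite /r; lra.
  rewrite -[r - 1]opprK !(powRN _ (- (r - 1))) lef_pV2 ?posrE ?powR_gt0 ?(lt_le_trans c0 cs)//.
  by apply: (ge0_ler_powR q0) => //; rewrite nnegrE ltW// (lt_le_trans c0 cs).
rewrite !normrM normrX normrN1 expr1n mul1r.
rewrite (ger0_norm a0) (ger0_norm (cheb_tail_ge0 _ _ _))// ger0_norm//.
by rewrite ler_piMr ?mulr_ge0 ?cheb_tail_ge0// ler_norml sin_geN1 sin_le1.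
Qed.

(** At [x = 0] the weight [cos^(-2a)] is singular, but the sum there is the tail itself. The
    constant depends on [x], which is harmless for finitely many eigenvalues. *)
Lemma cheb_sum_approx (R : realType) (a x : R) : 0 < a -> a <= 1 ->
  0 <= x -> x <= 1 -> exists2 K : R, 0 <= K & forall N : nat,
  `|(cheb_sum a N).[x] - (cheb_sum a N).[1] * x `^ a| <= K * cheb_tail a N.
Proof.
move=> a0 a1; rewrite le_eqVlt => /predU1P[<- _|x0 x1].
  exists 1 => // N; rewrite cheb_sum0 powR0 ?gt_eqF// mulr0 subr0 mul1r.
  by rewrite ger0_norm ?cheb_tail_ge0// ltW.
by apply: cheb_sum_approx_pos => //; exact: ltW.
Qed.

(** * Polynomial approximation at finitely many points *)

Lemma cheb_tail_small (R : realType) (a e : R) : 0 < a -> a <= 1 -> 0 < e ->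
  exists M : nat, forall N, (M <= N)%N -> cheb_tail a N <= e.
Proof.
move=> a0 a1 e0.
(* Solves [y^(2a) = 2/e], where 2 is a crude bound for [(1 - a)(1 + a)]. *)
pose y := (2 / e) `^ (2 * a)^-1.
have y0 : 0 <= y by exact: powR_ge0.
exists (Num.truncn y).+1 => -[//|N] MN.
apply: le_trans (cheb_tail_le _ (ltW a0) a1) _.
have aa : 0 < 2 * a by lra.
have yN : y <= N.+2%:R.
  apply: ltW; apply: lt_le_trans (truncnS_gt y) _.
  by rewrite ler_nat leqW.
have h : 2 / e <= N.+2%:R `^ (2 * a).
  have <- : y `^ (2 * a) = 2 / e.
    rewrite /y -powRrM mulVf ?lt0r_neq0// powRr1//.
    by rewrite divr_ge0// ltW.
  by apply: (ge0_ler_powR (ltW aa)); rewrite ?nnegrE.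
have p0 : 0 < N.+2%:R `^ (2 * a) by rewrite powR_gt0.
rewrite powRN ler_pdivrMr//.
apply: le_trans (_ : 2 <= _); last by rewrite mulrC -ler_pdivrMr.
nra.
Qed.

(** The polynomial is a short Chebyshev sum divided by the value [S] at 1 of a long one. The long
    sum stands in for the infinite series at the cost of [e]; the two sums differ by at most a tail,
    and [S >= 1 + a]. *)
Lemma powR_poly_approx (R : realType) (a : R) (d n : nat) (x : 'I_n -> R)
    (e : R) : 0 < a -> a <= 1 -> (forall l, 0 <= x l) -> (forall l, x l <= 1) ->
  0 < e -> exists2 p : {poly R}, (size p <= d.+2)%N &
    forall l, `|x l `^ a - p.[x l]| <= (1 - a) * d.+2%:R `^ (- (2 * a)) + e.
Proof.
move=> a0 a1 x0 x1 e0.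
have [K K0 KP] : exists2 K : R, 0 <= K & forall l (N : nat),
    `|(cheb_sum a N).[x l] - (cheb_sum a N).[1] * x l `^ a| <= K * cheb_tail a N.
  have /choice[k kP] (l : 'I_n) : exists K : R, 0 <= K /\ forall N : nat,
      `|(cheb_sum a N).[x l] - (cheb_sum a N).[1] * x l `^ a|
        <= K * cheb_tail a N.
    by have [K] := cheb_sum_approx a0 a1 (x0 l) (x1 l); exists K.
  (* The sum of the pointwise constants dominates each of them. *)
  exists (\sum_l k l); first by apply: sumr_ge0 => l _; have [] := kP l.
  move=> l N; apply: le_trans ((kP l).2 N) _.
  apply: ler_wpM2r; first by rewrite cheb_tail_ge0// ltW.
  by rewrite (bigD1 l)//= lerDl sumr_ge0// => l' _; have [] := kP l'.
have [M MP] := @cheb_tail_small R a (e / (K + 1)) a0 a1 ltac:(by rewrite divr_gt0//; lra).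
(* Even, as the lower bound at 1 requires, and beyond both [M] and [d + 1]. *)
pose N := (M + d).+1.*2.
have dN : (d.+1 <= N)%N by rewrite /N -addnn; lia.
have MN : (M <= N)%N by rewrite /N -addnn; lia.
have S1 := cheb_sum1_ge (M + d) (ltW a0) a1; rewrite -/N in S1.
set S := (cheb_sum a N).[1] in S1 *.
have S0 : 0 < S by lra.
exists (S^-1 *: cheb_sum a d.+1) => [|l].
  by rewrite (leq_trans (size_scale_leq _ _))// size_cheb_sum.
have xE : x l = cos (acos (Num.sqrt (x l))) ^+ 2.
  have q0 : 0 <= Num.sqrt (x l) by exact: sqrtr_ge0.
  have q1 : Num.sqrt (x l) <= 1 by rewrite -[leRHS]sqrtr1 ler_wsqrtr.
  by rewrite acosK ?sqr_sqrtr// in_itv /= q1 andbT; lra.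
have h1 := KP l N; rewrite -/S in h1.
have h2 := cheb_sum_dist d.+1 (N - d.+1) (acos (Num.sqrt (x l))) (ltW a0) a1.
rewrite -xE subnKC// in h2.
have h3 := cheb_tail_le d (ltW a0) a1.
have h4 : K * cheb_tail a N <= e.
  apply: le_trans (ler_wpM2l K0 (MP _ MN)) _.
  by rewrite mulrCA ler_piMr ?(ltW e0)// ler_pdivrMr; lra.
have h5 := cheb_tail_ge0 N (ltW a0) a1.
have -> : x l `^ a - (S^-1 *: cheb_sum a d.+1).[x l] =
  S^-1 * (((cheb_sum a N).[x l] - (cheb_sum a d.+1).[x l])
          - ((cheb_sum a N).[x l] - S * x l `^ a)).
  by rewrite hornerZ; field; lra.
rewrite normrM ger0_norm ?invr_ge0 ?(ltW S0)// ler_pdivrMl//.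
apply: le_trans (ler_normB _ _) _.
apply: le_trans (lerD h2 h1) _.
apply: le_trans (_ : (1 + a) * ((1 - a) * d.+2%:R `^ (- (2 * a)) + e) <= _); last first.
  apply: ler_wpM2r => //; apply: addr_ge0; last exact: ltW.
  by rewrite mulr_ge0 ?powR_ge0//; lra.
have : 0 <= a * e by rewrite mulr_ge0// ltW.
rewrite mulrDr mulrA [(1 + a) * (1 - a)]mulrC; lra.
Qed.

(** * Entries of functions of a matrix *)

Lemma unitary_diag_entryE (C : numClosedFieldType) n (P : 'M[C]_n)
    (v : 'rV[C]_n) i j : P \is unitarymx ->
  (invmx P *m diag_mx v *m P) i j = \sum_l (P l i)^* * v 0 l * P l j.
Proof.
move=> Pu; rewrite invmx_unitary// mul_mx_diag !mxE; apply: eq_bigr => l _.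
by rewrite !mxE.
Qed.

(** The columns of [P] are unit vectors, so by the arithmetic-geometric mean inequality the sum over
    [l] of [|P_li| |P_lj|] is at most 1. *)
Lemma unitary_diag_entry_le (C : numClosedFieldType) n (P : 'M[C]_n)
    (v : 'rV[C]_n) (c : C) i j : P \is unitarymx ->
  (forall l, `|v 0 l| <= c) -> `|(invmx P *m diag_mx v *m P) i j| <= c.
Proof.
move=> Pu vc; rewrite unitary_diag_entryE//.
have colP k : \sum_l `|P l k| ^+ 2 = 1.
  have := mulVmx (unitarymx_unit Pu); rewrite invmx_unitary//.
  move=> /matrixP /(_ k k); rewrite !mxE eqxx => E; apply: etrans E.
  by apply: eq_bigr => l _; rewrite !mxE normCKC.
have c0 : 0 <= c by exact: le_trans (normr_ge0 _) (vc i).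
apply: le_trans (ler_norm_sum _ _ _) _.
apply: le_trans (_ : \sum_l c * ((`|P l i| ^+ 2 + `|P l j| ^+ 2) / 2) <= _).
  apply: ler_sum => l _; rewrite !normrM norm_conjC mulrAC mulrC.
  apply: ler_pM => //.
  by have [] := real_leif_mean_square (normr_real (P l i)) (normr_real (P l j)).
by rewrite -mulr_sumr -mulr_suml big_split /= !colP divff// ?mulr1// pnatr_eq0.
Qed.

Lemma conj_mulmx (K : comUnitRingType) n (P D E : 'M[K]_n) : P \in unitmx ->
  invmx P *m (D *m E) *m P = invmx P *m D *m P *m (invmx P *m E *m P).
Proof. by move=> Pu; rewrite !mulmxA mulmxK. Qed.

(** The matrix is [A^k], and a nonzero entry needs a nonzero product of entries along some sequence
    from [i] to [j]. Diagonal factors are not edges and are skipped, whence [m <= k]. *)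
Lemma spectral_pow_walk (R : realType) n (A : 'M[R[i]]_n) k i j :
  A \is normalmx ->
  (invmx (spectralmx A) *m diag_mx (map_mx (fun z => z ^+ k) (spectral_diag A))
     *m spectralmx A) i j != 0 ->
  exists2 m, (m <= k)%N & walk_of_length (mx_edge A) i j m.
Proof.
move=> /orthomx_spectralP; set P := spectralmx A; set s := spectral_diag A => AE.
have Pu : P \in unitmx := unitarymx_unit (spectral_unitarymx A).
elim: k j => [|k IH] j.
  have -> : map_mx (fun z => z ^+ 0) s = const_mx 1.
    by apply/matrixP => x y; rewrite !mxE expr0.
  rewrite diag_const_mx mulmx1 mulVmx// mxE.
  have [<- _|_ /eqP//] := eqVneq i j.
  by exists 0%N => //; apply/existsP; exists [tuple] => /=.
have -> : diag_mx (map_mx (fun z => z ^+ k.+1) s) =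
    diag_mx (map_mx (fun z => z ^+ k) s) *m diag_mx s.
  rewrite mulmx_diag; congr diag_mx.
  by apply/matrixP => x y; rewrite !mxE ord1 exprSr.
rewrite conj_mulmx// -AE.
rewrite mxE => sum0.
have [l /andP[Ml Al]] : exists l, ((invmx P *m
    diag_mx (map_mx (fun z => z ^+ k) s) *m P) i l != 0) && (A l j != 0).
  apply/existsP; apply: contraNT sum0; rewrite negb_exists => /forallP h.
  apply/eqP; apply: big1 => l _; apply/eqP; rewrite mulf_eq0.
  by have := h l; rewrite negb_and !negbK.
have [m mk w] := IH l Ml.
have [lj|lj] := eqVneq l j; first by exists m; [exact: leqW|rewrite -lj].
exists m.+1 => //; case/existsP: w => p /andP[wp /eqP lp].
apply/existsP; exists [tuple of rcons p j].
by rewrite /= rcons_path wp lp last_rcons eqxx /mx_edge lj Al.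
Qed.

Lemma spectral_row_mul (R : realType) n (A : 'M[R[i]]_n) l : A \is normalmx ->
  row l (spectralmx A) *m A = spectral_diag A 0 l *: row l (spectralmx A).
Proof.
move=> /orthomx_spectralP; set P := spectralmx A; set s := spectral_diag A => AE.
have Pu : P \in unitmx := unitarymx_unit (spectral_unitarymx A).
rewrite AE -row_mul !mulmxA mulmxV// mul1mx.
by apply/rowP => j; rewrite mul_diag_mx !mxE.
Qed.

(** On the [l]-th unit eigenvector the quadratic form takes the eigenvalue as its value. *)
Lemma psd_spectral_ge0 (R : realType) n (A : 'M[R[i]]_n) l :
  psdmx A -> 0 <= spectral_diag A 0 l.
Proof.
move=> [Ah Ap]; have := Ap ((row l (spectralmx A))^t*)%sesqui.
rewrite trmxCK spectral_row_mul ?hermitian_normalmx// -scalemxAl mxE.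
have /row_unitarymxP/(_ l l) := spectral_unitarymx A.
by rewrite dotmxE eqxx => ->; rewrite mulr1.
Qed.

Lemma eigenvalue_spectral (R : realType) n (A : 'M[R[i]]_n) a :
  A \is normalmx -> eigenvalue A a -> exists l, a = spectral_diag A 0 l.
Proof.
move=> /orthomx_spectralP; set P := spectralmx A; set s := spectral_diag A => AE.
have Pu : P \in unitmx := unitarymx_unit (spectral_unitarymx A).
move=> /eigenvalueP[v vA v0].
pose w := v *m invmx P.
have w0 : w != 0.
  apply: contraNneq v0 => w0.
  by rewrite -[v](mulmxKV Pu) -/w w0 mul0mx.
have wD : w *m diag_mx s = a *: w.
  by rewrite /w scalemxAl -vA AE !mulmxA mulmxK.
clearbody w; have /rV0Pn [l wl] := w0.
exists l; have /rowP/(_ l) := wD.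
by rewrite mul_mx_diag !mxE mulrC => /(mulIf wl) ->.
Qed.

Lemma spectral_radius_ge (R : realType) n (A : 'M[R[i]]_n) l :
  psdmx A -> complex.Re (spectral_diag A 0 l) <= spectral_radius A.
Proof.
move=> Ap; have An : A \is normalmx by apply: hermitian_normalmx; case: Ap.
have s0 k : spectral_diag A 0 k = (complex.Re (spectral_diag A 0 k))%:C.
  by have /ger0_Im := psd_spectral_ge0 k Ap; case: (spectral_diag A 0 k) => x y /= ->.
have s1 k : 0 <= complex.Re (spectral_diag A 0 k).
  by rewrite -lecR -s0; exact: psd_spectral_ge0.
apply: sup_ubound.
  (* The supremum needs a bounded set; the eigenvalues being nonnegative, their sum is a bound. *)
  exists (\sum_k complex.Re (spectral_diag A 0 k)) => r [a Ea aE].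
  have [k ak] := eigenvalue_spectral An Ea.
  have -> : r = complex.Re (spectral_diag A 0 k).
    have := aE; rewrite ak ger0_norm ?psd_spectral_ge0//.
    by move=> /(congr1 (@complex.Re R)).
  by rewrite (bigD1 k)//= lerDl sumr_ge0.
exists (spectral_diag A 0 l).
  apply/eigenvalueP; exists (row l (spectralmx A)); first exact: spectral_row_mul.
  have /row_unitarymxP/(_ l l) := spectral_unitarymx A.
  rewrite eqxx; apply: contra_eq_neq => ->.
  by rewrite dotmxE mul0mx mxE eq_sym oner_eq0.
by rewrite {2}s0 ger0_norm// psd_spectral_ge0.
Qed.

Lemma normCR (R : realType) (x : R) : `|x%:C| = `|x|%:C.
Proof. by rewrite normc_def /= expr0n /= addr0 sqrtr_sqr. Qed.

(** Subtracting [rho^a p(A/rho)] with [p] of degree below [d + 2] leaves the entry unchanged, and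
    the remainder is small at every eigenvalue. Phrasing the hypothesis by walks also covers
    unconnected nodes, for every [d]. *)
Lemma mxpowR_entry_le (R : realType) n (A : 'M[R[i]]_n) (a : R) d i j :
  psdmx A -> 0 < a -> a <= 1 ->
  (forall k, walk_of_length (mx_edge A) i j k -> (d.+2 <= k)%N) ->
  `|mxpowR A a i j| <=
    (spectral_radius A `^ a * ((1 - a) * d.+2%:R `^ (- (2 * a))))%:C.
Proof.
move=> Ap a0 a1 hd.
have An : A \is normalmx by apply: hermitian_normalmx; case: Ap.
set rho := spectral_radius A; set P := spectralmx A; set s := spectral_diag A.
set B := (1 - a) * _.
have Pu : P \is unitarymx by exact: spectral_unitarymx.
pose re l := complex.Re (s 0 l).
have sE l : s 0 l = (re l)%:C.
  by have /ger0_Im := psd_spectral_ge0 l Ap; rewrite /re /s; case: (spectral_diag A 0 l) => x y /= ->.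
have re0 l : 0 <= re l by rewrite -lecR -sE; exact: psd_spectral_ge0.
have rer l : re l <= rho by exact: spectral_radius_ge.
have rho0 : 0 <= rho by apply: le_trans (rer i).
(* If [rho = 0], the quotient is 0 by convention and all eigenvalues vanish, so [xa] below holds in
   this case too. *)
pose x l := re l / rho.
have x0 l : 0 <= x l by rewrite divr_ge0.
have x1 l : x l <= 1.
  have [r0|r0] := eqVneq rho 0; first by rewrite /x r0 invr0 mulr0.
  by rewrite ler_pdivrMr ?mul1r// lt0r r0.
have xa l : re l `^ a = rho `^ a * x l `^ a.
  rewrite -powRM//; congr (_ `^ _); rewrite /x mulrC.
  have [r0|r0] := eqVneq rho 0; last by rewrite mulfVK.
  by rewrite r0 mulr0; apply/eqP; rewrite eq_le re0 -{1}r0 rer.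
have q0 : 0 <= rho `^ a by exact: powR_ge0.
have nE : `|mxpowR A a i j| = (complex.Re `|mxpowR A a i j|)%:C.
  by have /ger0_Im := normr_ge0 (mxpowR A a i j); case: (`|_|) => y z /= ->.
rewrite nE lecR; apply/ler_addgt0Pr => e e0.
have e1 : 0 < e / (rho `^ a + 1) by rewrite divr_gt0//; lra.
have [p sp hp] := powR_poly_approx d a0 a1 x0 x1 e1.
rewrite -lecR -nE.
pose w := \row_l ((rho `^ a * (x l `^ a - p.[x l]))%:C : R[i]).
have -> : mxpowR A a i j = (invmx P *m diag_mx w *m P) i j.
  rewrite /mxpowR !unitary_diag_entryE//; apply/eqP; rewrite -subr_eq0 -sumrB.
  (* [c k] are the coefficients of [rho^a p(z/rho)]. Each power of [A] involved has a zero entry,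
     since no walk is that short. *)
  apply/eqP; pose c k : R[i] := (rho `^ a * p`_k / rho ^+ k)%:C.
  transitivity (\sum_(k < d.+2) c k *
      (invmx P *m diag_mx (map_mx (fun z => z ^+ k) s) *m P) i j); last first.
    apply: big1 => k _.
    set m := (_ *m _) i j; have [->|m0] := eqVneq m 0; first by rewrite mulr0.
    have [m' m'k /hd] := spectral_pow_walk An m0.
    by rewrite ltnNge (leq_trans m'k)// -ltnS.
  under [RHS]eq_bigr do rewrite unitary_diag_entryE// mulr_sumr.
  rewrite exchange_big /=; apply: eq_bigr => l _.
  rewrite !mxE -mulrBl -mulrBr -rmorphB /= -/s -/(re l) xa -mulrBr opprB addrC subrK.
  rewrite (horner_coef_wide _ sp) mulr_sumr rmorph_sum /= mulr_sumr mulr_suml.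
  apply: eq_bigr => k _.
  rewrite !mxE sE -rmorphXn /= /c.
  have -> : rho `^ a * (p`_k * x l ^+ k) = rho `^ a * p`_k / rho ^+ k * re l ^+ k.
    by rewrite /x exprMn exprVn; ring.
  by rewrite [X in _ * X * _]rmorphM /=; ring.
apply: unitary_diag_entry_le => // l.
rewrite mxE normCR lecR normrM ger0_norm//.
apply: le_trans (ler_wpM2l q0 (hp l)) _; rewrite -/B mulrDr lerD2l.
by rewrite mulrCA ler_piMr ?(ltW e0)// ler_pdivrMr; lra.
Qed.

(** The previous bound holds for every [d] and tends to 0. *)
Lemma mxpowR_entry_disconnected (R : realType) n (A : 'M[R[i]]_n) (a : R) i j :
  psdmx A -> 0 < a -> a <= 1 ->
  (forall k, ~~ walk_of_length (mx_edge A) i j k) -> mxpowR A a i j = 0.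
Proof.
move=> Ap a0 a1 nw; apply/eqP; rewrite -normr_eq0 eq_le normr_ge0 andbT.
have nE : `|mxpowR A a i j| = (complex.Re `|mxpowR A a i j|)%:C.
  by have /ger0_Im := normr_ge0 (mxpowR A a i j); case: (`|_|) => y z /= ->.
rewrite nE lecR; apply/ler_addgt0Pr => e e0; rewrite add0r -lecR -nE.
pose q := spectral_radius A `^ a; have q0 : 0 <= q by exact: powR_ge0.
have e1 : 0 < e / (q + 1) by rewrite divr_gt0//; lra.
pose y := (e / (q + 1))^-1 `^ (2 * a)^-1.
have aa : 0 < 2 * a by lra.
have h := @mxpowR_entry_le R n A a (Num.truncn y) i j Ap a0 a1.
apply: le_trans (h _) _; first by move=> k; rewrite (negbTE (nw k)).
have iV : 0 <= (e / (q + 1))^-1 by rewrite invr_ge0 ltW.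
rewrite lecR -/q.
have d2 : (Num.truncn y).+2%:R `^ (- (2 * a)) <= e / (q + 1).
  rewrite powRN -[leRHS]invrK lef_pV2 ?posrE ?invr_gt0 ?powR_gt0//.
  have <- : y `^ (2 * a) = (e / (q + 1))^-1.
    by rewrite /y -powRrM mulVf ?lt0r_neq0// powRr1.
  apply: (ge0_ler_powR (ltW aa)); rewrite ?nnegrE ?powR_ge0//.
  by apply: ltW; apply: lt_le_trans (truncnS_gt y) _; rewrite ler_nat.
have p0 : 0 <= (Num.truncn y).+2%:R `^ (- (2 * a)) :> R by exact: powR_ge0.
apply: le_trans (_ : q * (e / (q + 1)) <= _).
  by apply: ler_wpM2l => //; apply: le_trans d2; rewrite ler_piMl//; lra.
by rewrite mulrCA ler_piMr ?(ltW e0)// ler_pdivrMr; lra.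
Qed.

(** * Gamma and error functions *)

(* For [0 < z <= 1] its derivative dominates the integrand of Gamma at [z], by
   concavity of [t ^ z]. *)
Definition gamma_prim (R : realType) (z t : R) : R :=
  z^-1 * ((t `^ z - z * t - 1) * expR (- t)).

Definition gamma_prim' (R : realType) (z t : R) : R :=
  z^-1 * ((z * t `^ (z - 1) - t `^ z + z * t + (1 - z)) * expR (- t)).

Lemma is_derive_gamma_prim (R : realType) (z t : R) : 0 < t ->
  is_derive t 1 (gamma_prim z) (gamma_prim' z t).
Proof.
move=> t0.
have d1 := is_derive1_powR z t0.
have d2 : is_derive t (1 : R) (fun x : R => z * x) z.
  by apply: is_derive_eq; rewrite [_ *: _]mulr1.
have d3 : is_derive t (1 : R) (fun x : R => expR (- x)) (- expR (- t)).
  have dN : is_derive t (1 : R) (fun x : R => - x) (- 1) by exact: is_deriveN.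
  by have := is_derive1_comp (is_derive_expR (- t)) dN; rewrite mulrN1.
have d4 : is_derive t (1 : R) (fun _ : R => 1 : R) 0 by exact: is_derive_cst.
have d := is_deriveZ z^-1 (is_deriveM (is_deriveB (is_deriveB d1 d2) d4) d3).
apply: (is_derive_eq d); rewrite /gamma_prim' /GRing.scale /=.
have -> : ((@powR R)^~ z - [eta *%R z] - (fun=> 1)) t = t `^ z - z * t - 1 by [].
by ring.
Qed.

Lemma gamma_integrand_le (R : realType) (z t : R) : 0 < z -> z <= 1 -> 0 < t ->
  t `^ (z - 1) * expR (- t) <= gamma_prim' z t.
Proof.
move=> z0 z1 t0; rewrite /gamma_prim' mulrA ler_wpM2r ?expR_ge0//.
rewrite ler_pdivlMl//.
have := @powR_le_affine R z t (ltW z0) z1 t0.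
by lra.
Qed.

Lemma continuous_powRl (R : realType) (z t : R) : 0 < t ->
  {for t, continuous ((@powR R) ^~ z)}.
Proof.
move=> t0; apply/differentiable_continuous/derivable1_diffP.
by have [] := is_derive1_powR z t0.
Qed.

Lemma continuous_expRN (R : realType) : continuous (fun t : R => expR (- t)).
Proof.
by move=> t; apply: continuous_comp; [exact: opp_continuous|exact: continuous_expR].
Qed.

Lemma continuous_gamma_prim' (R : realType) (z t : R) : 0 < t ->
  {for t, continuous (gamma_prim' z)}.
Proof.
move=> t0.
apply: cvgM; first exact: cvg_cst.
apply: cvgM; last exact: continuous_expRN.
apply: cvgD; last exact: cvg_cst.
apply: cvgD; last by apply: cvgM; [exact: cvg_cst|exact: cvg_id].
apply: cvgB; last exact: continuous_powRl.
by apply: cvgM; [exact: cvg_cst|exact: continuous_powRl].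
Qed.

Lemma measurable_gamma_integrand (R : realType) (z : R) (D : set R) :
  measurable_fun D (fun t : R => (t `^ (z - 1) * expR (- t))%:E).
Proof.
apply/measurable_EFinP/measurable_funM.
  by apply: measurable_funTS; exact: measurable_powR.
apply: measurable_funTS; apply: continuous_measurable_fun.
exact: continuous_expRN.
Qed.

(** Hence no increment of [gamma_prim] exceeds [1/z]. The lower bound rests on
    [(1 + zt) e^(-t) <= (1 + t) e^(-t) <= 1]. *)
Lemma gamma_prim_bounds (R : realType) (z t : R) : 0 < z -> z <= 1 -> 0 < t ->
  - z^-1 <= gamma_prim z t <= 0.
Proof.
move=> z0 z1 t0; have zV : 0 < z^-1 by rewrite invr_gt0.
have h := @powR_le_affine R z t (ltW z0) z1 t0.
have e0 := expR_gt0 (- t).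
rewrite /gamma_prim; apply/andP; split; last first.
  by rewrite mulr_ge0_le0 ?(ltW zV)// mulr_le0_ge0 ?(ltW e0)//; lra.
rewrite -[leLHS]mulrN1 ler_pM2l//.
have e1 : (1 + t) * expR (- t) <= 1.
  by rewrite expRN ler_pdivrMr ?expR_gt0// mul1r expR_ge1Dx.
have p0 : 0 <= t `^ z by exact: powR_ge0.
have zt : z * t <= t by rewrite ler_piMl// ltW.
nra.
Qed.

Lemma integral_gamma_itv_le (R : realType) (z b c : R) : 0 < z -> z <= 1 ->
  0 < b -> b < c ->
  (\int[lebesgue_measure]_(t in `[b, c]) (t `^ (z - 1) * expR (- t))%:E
    <= (z^-1)%:E)%E.
Proof.
move=> z0 z1 b0 bc.
have pos t : t \in `[b, c] -> 0 < t.
  by rewrite in_itv /= => /andP[bt _]; exact: lt_le_trans bt.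
have c0 := lt_trans b0 bc.
have cg' : {within `[b, c], continuous (gamma_prim' z)}.
  by apply: continuous_in_subspaceT => t /[!inE] /pos; exact: continuous_gamma_prim'.
apply: le_trans (_ : (\int[lebesgue_measure]_(t in `[b, c])
    (gamma_prim' z t)%:E <= _)%E).
  apply: ge0_le_integral => //.
  - by move=> t _; rewrite lee_fin mulr_ge0 ?powR_ge0 ?expR_ge0.
  - exact: measurable_gamma_integrand.
  - by apply/measurable_EFinP; exact: subspace_continuous_measurable_fun.
  - move=> t /pos t0; rewrite lee_fin; exact: gamma_integrand_le.
rewrite (@continuous_FTC2 R _ (gamma_prim z) b c bc cg').
- rewrite -EFinB lee_fin.
  have /andP[_ h1] := gamma_prim_bounds z0 z1 c0.
  have /andP[h2 _] := gamma_prim_bounds z0 z1 b0.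
  lra.
- have dF t : t \in `[b, c] -> derivable (gamma_prim z) t 1.
    by move=> /pos t0; have [] := is_derive_gamma_prim z t0.
  split.
  + by move=> t /subset_itv_oo_cc; exact: dF.
  + apply: cvg_at_right_filter; apply/differentiable_continuous/derivable1_diffP.
    by apply: dF; rewrite in_itv /= lexx ltW.
  + apply: cvg_at_left_filter; apply/differentiable_continuous/derivable1_diffP.
    by apply: dF; rewrite in_itv /= lexx ltW.
- move=> t /subset_itv_oo_cc /pos t0; rewrite derive1E.
  by have [] := is_derive_gamma_prim z t0.
Qed.

(** Being about the extended-real integral, the bound also yields convergence, so that [Gamma z] is
    not the default value 0. *)
Lemma integral_gamma_le (R : realType) (z : R) : 0 < z -> z <= 1 ->
  (\int[lebesgue_measure]_(t in `[0%R, +oo[) (t `^ (z - 1) * expR (- t))%:E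
    <= (z^-1)%:E)%E.
Proof.
move=> z0 z1; rewrite -integral_itv_obnd_cbnd; last exact: measurable_gamma_integrand.
(* Compact intervals exhausting the open half-line, for monotone convergence; starting from 2 keeps
   them nondegenerate. *)
pose F (k : nat) : set R := `[k.+2%:R^-1, k.+2%:R]%classic.
have -> : `]0%R, +oo[%classic = \bigcup_k F k.
  apply/seteqP; split=> t; last first.
    move=> [k _]; rewrite /F /= !in_itv /= => /andP[kt _].
    by rewrite andbT (lt_le_trans _ kt)// invr_gt0.
  rewrite /= in_itv /= andbT => t0.
  exists (Num.truncn t + Num.truncn t^-1)%N => //; rewrite /F /= in_itv /=.
  rewrite invf_ple ?posrE//; apply/andP; split; apply: ltW;
    apply: lt_le_trans (truncnS_gt _) _;
    by rewrite ler_nat leqW// ltnS ?leq_addr ?leq_addl.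
have nd : {homo F : n m / (n <= m)%N >-> (n <= m)%O}.
  move=> k m km; apply/subsetPset => y; rewrite /F /= !in_itv /= => /andP[h1 h2].
  apply/andP; split.
    by apply: le_trans h1; rewrite lef_pV2 ?posrE// ler_nat !ltnS.
  by apply: le_trans h2 _; rewrite ler_nat !ltnS.
have cv : (\int[lebesgue_measure]_(t in F k)
      (t `^ (z - 1) * expR (- t))%:E)%E @[k --> \oo] -->
    (\int[lebesgue_measure]_(t in \bigcup_k F k)
      (t `^ (z - 1) * expR (- t))%:E)%E.
  apply: ge0_nondecreasing_set_cvg_integral => //.
  - by move=> k; exact: measurable_itv.
  - by move=> k; exact: measurable_gamma_integrand.
  - by move=> k t _; rewrite lee_fin mulr_ge0 ?powR_ge0 ?expR_ge0.
apply: cvge_le cv; apply: nearW => k.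
apply: integral_gamma_itv_le => //; rewrite ?invr_gt0//.
by apply: (@lt_trans _ _ 1); rewrite ?invf_lt1// ltr1n.
Qed.

Lemma Gamma_le (R : realType) (z : R) : 0 < z -> z <= 1 -> Gamma z <= z^-1.
Proof.
move=> z0 z1; rewrite /Gamma /upper_gamma /Rintegral.
rewrite -lee_fin fineK ?integral_gamma_le// ge0_fin_numE.
  by apply: le_lt_trans (integral_gamma_le z0 z1) _; exact: ltry.
by apply: integral_ge0 => t _; rewrite lee_fin mulr_ge0 ?powR_ge0 ?expR_ge0.
Qed.

Lemma upper_gamma_antitone (R : realType) (z b c : R) : 0 < z -> z <= 1 ->
  0 <= b -> b <= c -> upper_gamma z c <= upper_gamma z b.
Proof.
move=> z0 z1 b0 bc.
have sub x y : x <= y ->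
    (\int[lebesgue_measure]_(t in `[y, +oo[) (t `^ (z - 1) * expR (- t))%:E
     <= \int[lebesgue_measure]_(t in `[x, +oo[) (t `^ (z - 1) * expR (- t))%:E)%E.
  move=> xy; apply: ge0_subset_integral => //.
  - exact: measurable_gamma_integrand.
  - by move=> t _; rewrite lee_fin mulr_ge0 ?powR_ge0 ?expR_ge0.
  - by apply: subset_itvr; rewrite bnd_simp.
have fin x : 0 <= x ->
    (\int[lebesgue_measure]_(t in `[x, +oo[) (t `^ (z - 1) * expR (- t))%:E
      \is a fin_num)%E.
  move=> x0; rewrite ge0_fin_numE.
    apply: le_lt_trans (sub _ _ x0) _.
    by apply: le_lt_trans (integral_gamma_le z0 z1) _; exact: ltry.
  by apply: integral_ge0 => t _; rewrite lee_fin mulr_ge0 ?powR_ge0 ?expR_ge0.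
by rewrite /upper_gamma /Rintegral fine_le ?fin ?sub// (le_trans b0).
Qed.

(** On [[1, 2]] the integrand is decreasing, hence at least its value [m] at 2. *)
Lemma Gamma_gt0 (R : realType) (z : R) : 0 < z -> z <= 1 -> 0 < Gamma z.
Proof.
move=> z0 z1.
pose m : R := 2 `^ (z - 1) * expR (- 2).
have m0 : 0 < m by rewrite mulr_gt0 ?powR_gt0 ?expR_gt0.
suff : (m%:E <= \int[lebesgue_measure]_(t in `[0%R, +oo[)
                 (t `^ (z - 1) * expR (- t))%:E)%E.
  move=> h; apply: lt_le_trans m0 _; rewrite -lee_fin /Gamma /upper_gamma.
  rewrite /Rintegral fineK// ge0_fin_numE.
    by apply: le_lt_trans (integral_gamma_le z0 z1) _; exact: ltry.
  by apply: integral_ge0 => t _; rewrite lee_fin mulr_ge0 ?powR_ge0 ?expR_ge0.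
have -> : m%:E = (\int[lebesgue_measure]_(t in `[1%R, 2%R]) (cst m%:E) t)%E.
  rewrite integral_cst//= lebesgue_measure_itv /= lte_fin ltr1n -EFinB.
  by rewrite -EFinM; congr EFin; lra.
apply: le_trans (_ : (\int[lebesgue_measure]_(t in `[1%R, 2%R])
                 (t `^ (z - 1) * expR (- t))%:E <= _)%E).
  apply: ge0_le_integral => //.
  - by move=> t _; rewrite lee_fin ltW.
  - exact: measurable_gamma_integrand.
  - move=> t; rewrite /= in_itv /= => /andP[t1 t2]; rewrite lee_fin.
    have t0 : 0 < t by lra.
    apply: ler_pM; rewrite ?powR_ge0 ?expR_ge0// ?ler_expR; last lra.
    rewrite -[z - 1]opprB !(powRN _ (1 - z)) lef_pV2 ?posrE ?powR_gt0//.
    by apply: ge0_ler_powR; rewrite ?nnegrE//; lra.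
apply: ge0_subset_integral => //.
- exact: measurable_gamma_integrand.
- by move=> t _; rewrite lee_fin mulr_ge0 ?powR_ge0 ?expR_ge0.
- by move=> t; rewrite /= !in_itv /= => /andP[t1 _]; rewrite andbT; lra.
Qed.

Lemma erf_monotone (R : realType) (b c : R) : b <= c -> erf b <= erf c.
Proof.
move=> bc; rewrite /erf ler_wpM2l ?invr_ge0 ?sqrtr_ge0//.
have ce : continuous (fun t : R => expR (- t ^+ 2)).
  move=> t; apply: continuous_comp; last exact: continuous_expR.
  apply: continuous_comp; last exact: opp_continuous.
  exact: exprn_continuous.
have int x y : lebesgue_measure.-integrable `[x, y] (EFin \o (fun t : R => expR (- t ^+ 2))).
  apply: continuous_compact_integrable; first exact: segment_compact.
  exact: continuous_subspaceT.
apply: fine_le; [exact: integrable_fin_num|exact: integrable_fin_num|].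
apply: ge0_subset_integral => //.
- by have /integrableP[] := int (- c) c.
- move=> t; rewrite /= !in_itv /= => /andP[h1 h2].
  by apply/andP; split; lra.
Qed.

(** * Geodesic distance and the final estimate *)

Lemma geodesic_dist_some (T : finType) (e : rel T) x y d :
  geodesic_dist e x y = Some d -> forall k, walk_of_length e x y k -> (d <= k)%N.
Proof.
rewrite /geodesic_dist; case: pselect => // h [<-] k wk.
by case: ex_minnP => m _; exact.
Qed.

Lemma geodesic_dist_none (T : finType) (e : rel T) x y :
  geodesic_dist e x y = None -> forall k, ~~ walk_of_length e x y k.
Proof.
rewrite /geodesic_dist; case: pselect => // h _ k; apply/negP => wk.
by apply: h; exists k.
Qed.

Lemma lower_gamma_ge0 (R : realType) (z s : R) : 0 <= lower_gamma z s.
Proof.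
by apply: Rintegral_ge0 => t _; rewrite mulr_ge0 ?powR_ge0 ?expR_ge0.
Qed.

(** Plays for [a = 1/2] the part of [Gamma(1 - a) <= 1 / (1 - a)]. *)
Lemma sqrt_pi_le2 (R : realType) : Num.sqrt pi <= 2 :> R.
Proof.
have h : 2 = Num.sqrt (2 ^+ 2) :> R by rewrite sqrtr_sqr ger0_norm.
rewrite [leRHS]h ler_sqrt ?exprn_gt0//.
by have := pihalf_lt2 R; rewrite expr2; lra.
Qed.

(* At distance infinity (None) the bounds are read as their limits for
   d -> oo, which are 0. *)
Theorem theorem3p3 (R : realType) (n : nat) (A : 'M[R[i]]_n)
    (A_psd : psdmx A) :
  (forall alpha : R, 0 < alpha -> alpha < 1 ->
   forall i j : 'I_n,
   match geodesic_dist (mx_edge A) i j with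
   | Some d => (2 <= d)%N ->
      `|mxpowR A alpha i j| <=
      (alpha / Gamma (1 - alpha) *
       (10 * expR d%:R * spectral_radius A `^ alpha
          / (4 `^ alpha * d%:R ^+ d)
          * lower_gamma (d%:R - alpha - 1) (d%:R / 2)
        + 10 * (5 * spectral_radius A / (4 * d%:R ^+ 2)) `^ alpha
          * (upper_gamma alpha (4 / 5) - upper_gamma alpha (2 * d%:R / 5))
        + spectral_radius A `^ alpha / (alpha * d%:R `^ (2 * alpha))))%:C
   | None => `|mxpowR A alpha i j| <= 0
   end)
  /\
  (forall i j : 'I_n,
   match geodesic_dist (mx_edge A) i j with
   | Some d => (2 <= d)%N ->
      `|mxpowR A (1 / 2) i j| <=
      (1 / (2 * Num.sqrt pi) *
       (10 * expR d%:R * Num.sqrt (pi * spectral_radius A)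
          / (2 * d%:R ^+ d)
          * lower_gamma (d%:R - 3 / 2) (d%:R / 2)
        + 5 * Num.sqrt (5 * pi * spectral_radius A) / d%:R
          * (erfc (2 / Num.sqrt 5) - erfc (Num.sqrt (2 * d%:R / 5)))
        + 2 * Num.sqrt (spectral_radius A) / d%:R))%:C
   | None => `|mxpowR A (1 / 2) i j| <= 0
   end).
Proof.
split=> [a a0 a1|] i j; case gd : geodesic_dist => [d|].
- case: d gd => [//|[//|d]] gd _.
  apply: le_trans (mxpowR_entry_le A_psd a0 (ltW a1) (geodesic_dist_some gd)) _.
  rewrite lecR; set D : R := d.+2%:R; set rho := spectral_radius A.
  have z0 : 0 < 1 - a by lra.
  have z1 : 1 - a <= 1 by lra.
  have G0 := Gamma_gt0 z0 z1; have G1 := Gamma_le z0 z1.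
  have D2 : 2 <= D by rewrite /D ler_nat.
  set X := 10 * expR D * rho `^ a / _ * _.
  have X0 : 0 <= X.
    rewrite /X !mulr_ge0 ?expR_ge0 ?powR_ge0 ?lower_gamma_ge0// invr_ge0.
    by rewrite mulr_ge0 ?powR_ge0 ?exprn_ge0.
  set Y := 10 * _ `^ a * _.
  have Y0 : 0 <= Y.
    rewrite /Y mulr_ge0 ?mulr_ge0 ?powR_ge0// subr_ge0.
    (* [4/5 <= 2D/5] is the assumption [D >= 2]. *)
    by apply: upper_gamma_antitone => //; lra.
  apply: le_trans (_ : a / Gamma (1 - a) * (rho `^ a / (a * D `^ (2 * a))) <= _);
    last first.
    by apply: ler_wpM2l; [rewrite divr_ge0 ?ltW//|rewrite lerDr addr_ge0].
  rewrite powRN; have DP : 0 < D `^ (2 * a) by rewrite powR_gt0//; lra.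
  have -> : a / Gamma (1 - a) * (rho `^ a / (a * D `^ (2 * a))) =
      rho `^ a * ((Gamma (1 - a))^-1 * (D `^ (2 * a))^-1).
    by field; rewrite !gt_eqF.
  apply: ler_wpM2l; first exact: powR_ge0.
  apply: ler_wpM2r; first by rewrite invr_ge0 ltW.
  (* What remains is [1 - a <= 1 / Gamma(1 - a)]. *)
  by rewrite -[leLHS]invrK lef_pV2 ?posrE ?invr_gt0.
- by rewrite (mxpowR_entry_disconnected A_psd a0 (ltW a1) (geodesic_dist_none gd)) normr0.
- case: d gd => [//|[//|d]] gd _.
  have h0 : 0 < 1 / 2 :> R by lra.
  have h1 : 1 / 2 <= 1 :> R by lra.
  apply: le_trans (mxpowR_entry_le A_psd h0 h1 (geodesic_dist_some gd)) _.
  rewrite lecR; set D : R := d.+2%:R; set rho := spectral_radius A.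
  have D2 : 2 <= D by rewrite /D ler_nat.
  have D0 : 0 < D by lra.
  have r2 : 2 * (1 / 2) = 1 :> R by lra.
  rewrite r2 powR_inv1 ?(ltW D0)// div1r powR12_sqrt; last first.
    apply: le_trans (spectral_radius_ge i A_psd).
    by have := psd_spectral_ge0 i A_psd; rewrite lecE => /andP[].
  set X := 10 * expR D * _ / _ * _.
  have X0 : 0 <= X.
    rewrite /X !mulr_ge0 ?expR_ge0 ?sqrtr_ge0 ?lower_gamma_ge0// invr_ge0.
    by rewrite mulr_ge0 ?exprn_ge0 ?(ltW D0).
  set Y := 5 * _ / D * _.
  have Y0 : 0 <= Y.
    rewrite /Y mulr_ge0 ?mulr_ge0 ?invr_ge0 ?sqrtr_ge0 ?(ltW D0)// subr_ge0.
    rewrite /erfc lerD2l lerN2; apply: erf_monotone.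
    (* With both arguments as square roots, the comparison is again [4/5 <= 2D/5]. *)
    have -> : 2 / Num.sqrt 5 = Num.sqrt (4 / 5) :> R.
      have -> : 4 / 5 = (2 / Num.sqrt 5) ^+ 2 :> R.
        by rewrite exprMn exprVn sqr_sqrtr//; lra.
      by rewrite sqrtr_sqr ger0_norm// divr_ge0// sqrtr_ge0.
    by rewrite ler_sqrt; lra.
  have P0 : 0 < Num.sqrt pi :> R by rewrite sqrtr_gt0 pi_gt0.
  apply: le_trans (_ : 1 / (2 * Num.sqrt pi) * (2 * Num.sqrt rho / D) <= _);
    last by apply: ler_wpM2l; [rewrite divr_ge0 ?mulr_ge0 ?ltW//|rewrite lerDr addr_ge0].
  have -> : 1 / (2 * Num.sqrt pi) * (2 * Num.sqrt rho / D) =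
      Num.sqrt rho * ((Num.sqrt pi)^-1 * D^-1).
    by field; rewrite !gt_eqF.
  apply: ler_wpM2l; first exact: sqrtr_ge0.
  apply: ler_wpM2r; first by rewrite invr_ge0 ltW.
  have -> : 1 - 2^-1 = 2^-1 :> R by lra.
  by rewrite lef_pV2 ?posrE// sqrt_pi_le2.
- rewrite (mxpowR_entry_disconnected A_psd _ _ (geodesic_dist_none gd)) ?normr0//; lra.
Qed.
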